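(* Let $\psi\in C^1(\mathbb{R}^2,\mathbb{R}^2)$, let $\phi\in C(\mathbb{R}\times\mathbb{R}^2\times[0,1],\mathbb{R}^2)$ be $T$-periodic in its first variable, and assume that $\dot x=\psi(x)$ has a limit cycle $x_0$ of smallest period $T>0$ such that the linearized system $\dot y=\psi'(x_0(t))y$ has only one characteristic multiplier equal to $1$. Assume that there is $\theta_0\in[0,T]$ such that, for all sufficiently small $\varepsilon>0$, the system $\dot x=\psi(x)+\varepsilon\phi(t,x,\varepsilon)$ has a $T$-periodic solution $x_\varepsilon$ satisfying $x_\varepsilon(t-\theta_0)\to x_0(t)$ as $\varepsilon\to0$ for any $t\in[0,T]$. Moreover, assume that $$f_1(\theta_0,t)\neq0\quad\text{for any }t\in[0,T].$$ Then there exists $\varepsilon_1>0$ such that $x_\varepsilon(s)\neq x_0(t)$ for any $s,t\in[0,T]$ and any $\varepsilon\in(0,\varepsilon_1)$.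
   Context: An eigenfunction of a linear $T$-periodic system corresponding to a characteristic multiplier $\rho$ is a nontrivial solution $y$ with $y(t+T)=\rho\,y(t)$. ''Only one characteristic multiplier equal to $1$'' means that $1$ is a simple multiplier. The function $z_1$ is an eigenfunction of the adjoint system $\dot z=-(\psi'(x_0(t)))^*z$ ($*$ = transpose) corresponding to the characteristic multiplier $\rho_*\neq1$, and $$f_1(\theta,s)=\int_{s-T}^s\langle z_1(\tau),\phi(\tau-\theta,x_0(\tau),0)\rangle\,d\tau .$$ *)

(* Defs.v *)
From HB Require Import structures.
From mathcomp Require Import all_boot all_order all_algebra.
From mathcomp Require Import all_classical all_reals all_analysis.

Set Implicit Arguments.
Unset Strict Implicit.
Unset Printing Implicit Defensive.

Import Order.TTheory GRing.Theory Num.Theory.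
Import numFieldNormedType.Exports.

Local Open Scope classical_set_scope.
Local Open Scope ring_scope.

(* The plane is 'rV[R]_2, as required by
   [jacobian]: 'd f p v = v *m jacobian f p, so [jacobian f p] is the transpose
   of the usual Jacobian matrix (the one acting on columns), linear systems
   read y' = y *m A t, and linear maps act on the right. *)

Definition solution (R : realType) (V : normedModType R)
    (F : R -> V -> V) (x : R -> V) : Prop :=
  forall t : R, is_derive t (1 : R) x (F t (x t)).

Definition C1 (R : realType) (psi : 'rV[R]_2 -> 'rV[R]_2) : Prop :=
  (forall p, differentiable psi p) /\ continuous (jacobian psi).

Definition least_period (R : realType) (V : zmodType) (T : R) (x : R -> V) :
    Prop :=
  [/\ 0 < T, periodic x T & forall S : R, 0 < S -> periodic x S -> T <= S].

(* Having a least positive period excludes the equilibria. *)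
Definition cycle (R : realType) (psi : 'rV[R]_2 -> 'rV[R]_2) (T : R)
    (x : R -> 'rV[R]_2) : Prop :=
  solution (fun=> psi) x /\ least_period T x.

(* A limit cycle is an isolated cycle: some neighbourhood of its orbit contains
   the orbit of no other cycle. *)
Definition limit_cycle (R : realType) (psi : 'rV[R]_2 -> 'rV[R]_2) (T : R)
    (x : R -> 'rV[R]_2) : Prop :=
  cycle psi T x /\
  exists U : set 'rV[R]_2, [/\ open U, range x `<=` U &
    forall (S : R) (y : R -> 'rV[R]_2),
      cycle psi S y -> range y `<=` U -> range y = range x].

Definition linear_field (R : realType) (m : nat) (A : R -> 'M[R]_2) :
    R -> 'M[R]_(m, 2) -> 'M[R]_(m, 2) :=
  fun t y => y *m A t.

Definition linearization (R : realType) (psi : 'rV[R]_2 -> 'rV[R]_2)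
    (x : R -> 'rV[R]_2) : R -> 'M[R]_2 :=
  fun t => jacobian psi (x t).

Definition adjoint (R : realType) (A : R -> 'M[R]_2) : R -> 'M[R]_2 :=
  fun t => - (A t)^T.

(* Y is the fundamental matrix normalized at 0 (its rows are solutions), Y T is
   the monodromy matrix, and its eigenvalues are the characteristic multipliers
   of the T-periodic system, counted with algebraic multiplicity. *)
Definition simple_multiplier (R : realType) (A : R -> 'M[R]_2) (T rho : R) :
    Prop :=
  exists Y : R -> 'M[R]_2,
    [/\ solution (linear_field A) Y, Y 0 = 1%:M &
        mup rho (char_poly (Y T)) = 1%N].

Definition eigenfunction (R : realType) (A : R -> 'M[R]_2) (T rho : R)
    (y : R -> 'rV[R]_2) : Prop :=
  [/\ solution (linear_field A) y, (exists t, y t != 0) &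
      forall t, y (t + T) = rho *: y t].

Definition dot (R : realType) (u v : 'rV[R]_2) : R :=
  \sum_(i < 2) u 0 i * v 0 i.

Definition f1 (R : realType) (phi : R -> 'rV[R]_2 -> R -> 'rV[R]_2)
    (x0 z1 : R -> 'rV[R]_2) (T theta s : R) : R :=
  \int[@lebesgue_measure R]_(tau in `[s - T, s])
    dot (z1 tau) (phi (tau - theta) (x0 tau) 0).

(* Main.v *)
Require Import Defs.
From HB Require Import structures.
From mathcomp Require Import all_boot all_order all_algebra.
From mathcomp Require Import all_classical all_reals all_analysis.
From mathcomp Require Import ring lra.

Set Implicit Arguments.
Unset Strict Implicit.
Unset Printing Implicit Defensive.

Import Order.TTheory GRing.Theory Num.Theory.
Import numFieldNormedType.Exports.

Local Open Scope classical_set_scope.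
Local Open Scope ring_scope.

(* After the shift y(t) = x eps (t - theta0), suppose y meets the orbit of x0 at
   time u. Compare y not with x0 but with the translate w of x0 through the
   meeting point: y - w is T-periodic and vanishes at u - T and at u. Gronwall's
   inequality for |y - w|^2 gives y - w = O(eps), uniformly on [u - T, u], while
   y and w both converge to x0. Since z1 solves the adjoint equation, the
   derivative of <z1, y - w> is eps <z1, phi(t - theta0, x0, 0)> + o(eps);
   integrating over [u - T, u] yields f1(theta0, u) = o(1), whereas |f1| is
   bounded below on [0, T]. *)

(** * Mean value theorem and Gronwall inequalities *)

Lemma mean_value (R : realType) (f df : R -> R) (a b : R) : a < b ->
  (forall t, a <= t <= b -> is_derive t (1 : R) f (df t)) ->
  exists2 c, a < c < b & f b - f a = df c * (b - a).
Proof.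
move=> ab fE.
have fE' t : t \in `]a, b[ -> is_derive t (1 : R) f (df t).
  by rewrite in_itv/= => /andP[? ?]; apply: fE; rewrite !ltW.
have [|c] := MVT ab fE'; last by rewrite in_itv /=; exists c.
apply: continuous_in_subspaceT => t; rewrite inE/= in_itv/= => tab.
have [dft _] := fE _ tab.
exact/differentiable_continuous/derivable1_diffP.
Qed.

Lemma is_derive_translate (R : realType) (V : normedModType R)
    (x : R -> V) (b t : R) (dx : V) :
  is_derive (t + b) (1 : R) x dx ->
  is_derive t (1 : R) (fun s => x (s + b)) dx.
Proof.
have e : (fun h : R => h^-1 *: (x (h *: (1 : R) + t + b) - x (t + b))) =
    (fun h : R => h^-1 *: (x (h *: (1 : R) + (t + b)) - x (t + b))).
  by apply/funext => h; rewrite addrA.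
by move=> [dxt dxE]; split; [rewrite /derivable /= e|rewrite /derive /= e].
Qed.

(** The integrating factor [expR (- k * t + k * a)] is at most 1 on the interval, so [E] times it
    minus [c * t] has nonpositive derivative there. The resulting bound is not sharp, but involves
    no division by [k]. *)
Lemma gronwall_step (R : realType) (E dE : R -> R) (a b k c : R) :
  0 <= k -> 0 <= c -> a < b ->
  (forall t, is_derive t (1 : R) E (dE t)) ->
  (forall t, a < t < b -> dE t <= k * E t + c) ->
  E b <= (E a + c * (b - a)) * expR (k * (b - a)).
Proof.
move=> k0 c0 ab EE dEle.
pose g t := E t * expR (- k * t + k * a) - c * t.
have gE t : is_derive t (1 : R) g
    ((dE t - k * E t) * expR (- k * t + k * a) - c).
  have h2 : is_derive t (1 : R) (fun s : R => c * s) c.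
    by apply: is_derive_eq (mulr1 c).
  have h3 : is_derive t (1 : R) (fun s : R => - k * s + k * a) (- k).
    by apply: is_derive_eq; rewrite addr0; exact: mulr1.
  have h1 := @is_derive1_comp R expR _ t _ _ (is_derive_expR _) h3.
  have := is_deriveB (is_deriveM (EE t) h1) h2.
  rewrite /= => /is_derive_eq; apply.
  by rewrite /GRing.scale/=; ring.
have [s /andP[as_ sb] gba] := mean_value ab (fun t _ => gE t).
have : g b <= g a.
  rewrite -subr_le0 gba mulr_le0_ge0 ?subr_ge0 ?(ltW ab)//.
  have h1 : dE s - k * E s <= c by rewrite lerBlDl dEle// as_.
  have h2 : expR (- k * s + k * a) <= 1.
    rewrite -expR0 ler_expR.
    by have := mulr_ge0 k0 (ltW (_ : 0 < s - a)); rewrite subr_gt0 as_ => /(_ isT); lra.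
  rewrite subr_le0 (le_trans (ler_wpM2r (expR_ge0 _) h1))//.
  by rewrite -[leRHS]mulr1 ler_wpM2l.
rewrite /g !mulNr addNr expR0 mulr1 => h.
have -> : E b = E b * expR (- (k * b) + k * a) * expR (k * (b - a)).
  by rewrite -mulrA -expRD (_ : _ + _ = 0) ?expR0 ?mulr1//; ring.
by rewrite ler_wpM2r ?expR_ge0//; move: h; lra.
Qed.

(** The differential inequality is assumed only where [E] is at most [r]. A continuity argument
    removes this restriction: up to a first time at which [E] reaches [r], [gronwall_step] applies
    and keeps [E] strictly below [r], so there is no such time. *)
Lemma gronwall (R : realType) (E dE : R -> R) (a b k c r : R) :
  0 <= k -> 0 <= c -> 0 <= E a ->
  (forall t, is_derive t (1 : R) E (dE t)) ->
  (forall t, a <= t <= b -> E t <= r -> dE t <= k * E t + c) ->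
  (E a + c * (b - a)) * expR (k * (b - a)) < r ->
  forall t, a <= t <= b -> E t <= (E a + c * (b - a)) * expR (k * (b - a)).
Proof.
move=> k0 c0 Ea0 EE dEle ltr t /andP[at_ tb].
have cE : continuous E.
  by move=> s; have [? _] := EE s; exact/differentiable_continuous/derivable1_diffP.
have step s : a <= s <= b -> (forall u, a < u < s -> E u <= r) ->
    E s <= (E a + c * (b - a)) * expR (k * (b - a)).
  move=> /andP[as_ sb] Eur.
  apply: (@le_trans _ _ ((E a + c * (s - a)) * expR (k * (s - a)))).
    move: as_; rewrite le_eqVlt => /predU1P[->|as_].
      by rewrite !subrr !mulr0 addr0 expR0 mulr1.
    apply: gronwall_step EE _ => // u /andP[au us].
    by apply: dEle; [rewrite ltW//= (le_trans (ltW us))|rewrite Eur// au].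
  apply: ler_pM; rewrite ?expR_ge0//.
  - by rewrite addr_ge0// mulr_ge0// subr_ge0.
  - by rewrite lerD2l ler_wpM2l// lerD2r.
  - by rewrite ler_expR ler_wpM2l// lerD2r.
apply: (step); first by rewrite at_.
move=> u /andP[au ut].
rewrite leNgt; apply/negP => rEu.
(* The least element [s0] of this compact set is the first time at which [E] is at least [r]. *)
pose S := `[a, u] `&` E @^-1` [set y | r <= y].
have cS : compact S.
  apply: (@subclosed_compact _ _ `[a, u]); last 2 first.
  - exact: segment_compact.
  - by move=> s [].
  apply: closedI; first exact: itv_closed.
  by refine (@preimage_closed _ _ E _ _ (@closed_ge R r)) => ? _; exact: cE.
have Su : S u by split; [rewrite /= in_itv/= lexx ltW|exact: ltW].
have [|s0] := compact_EVT_min (f := id) (ex_intro _ u Su) cS.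
  by apply: continuous_subspaceT => ?; exact: cvg_id.
rewrite inE => -[/=]; rewrite in_itv/= => /andP[as0 s0u] rEs0 s0min.
have : E s0 <= (E a + c * (b - a)) * expR (k * (b - a)).
  apply: step; first by rewrite as0/= (le_trans s0u)// (le_trans (ltW ut)).
  move=> v /andP[av vs0]; rewrite leNgt; apply/negP => /ltW rEv.
  suff : s0 <= v by rewrite leNgt vs0.
  apply: s0min; rewrite inE; split => //=.
  by rewrite in_itv/= (ltW av) (le_trans (ltW vs0)).
by move/(le_lt_trans) => /(_ _ ltr); rewrite ltNge rEs0.
Qed.

(** * The scalar product and the norm of the plane *)

Lemma is_derive_dot (R : realType) (u v : R -> 'rV[R]_2) (du dv : 'rV[R]_2)
    (t : R) :
  is_derive t (1 : R) u du -> is_derive t (1 : R) v dv ->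
  is_derive t (1 : R) (fun s => dot (u s) (v s)) (dot du (v t) + dot (u t) dv).
Proof.
have coord (w : R -> 'rV[R]_2) dw i : is_derive t (1 : R) w dw ->
    is_derive t (1 : R) (fun s => w s 0 i) (dw 0 i).
  move=> [dwt dwE]; split; first by move/derivable_mxP : dwt; apply.
  by rewrite -dwE derive_mx// mxE.
move=> uE vE.
have := is_derive_sum (fun i => is_deriveM (coord u du i uE) (coord v dv i vE)).
rewrite (_ : \sum_(i < 2) _ = fun s => dot (u s) (v s)); last first.
  by apply/funext => s; rewrite fct_sumE.
move=> /is_derive_eq; apply.
by rewrite /dot -big_split; apply: eq_bigr => i _; rewrite /GRing.scale/=; ring.
Qed.

Lemma dotC (R : realType) (u v : 'rV[R]_2) : dot u v = dot v u.
Proof. by apply: eq_bigr => i _; rewrite mulrC. Qed.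

Lemma dotDr (R : realType) (u v w : 'rV[R]_2) :
  dot u (v + w) = dot u v + dot u w.
Proof. by rewrite /dot -big_split; apply: eq_bigr => i _; rewrite !mxE mulrDr. Qed.

Lemma dotZr (R : realType) (a : R) (u v : 'rV[R]_2) :
  dot u (a *: v) = a * dot u v.
Proof. by rewrite /dot mulr_sumr; apply: eq_bigr => i _; rewrite !mxE mulrCA. Qed.

Lemma dotBr (R : realType) (u v w : 'rV[R]_2) :
  dot u (v - w) = dot u v - dot u w.
Proof. by rewrite -scaleN1r dotDr dotZr mulN1r. Qed.

(** This cancellation makes [dot z y] constant along solutions of a linear system and of its
    adjoint. *)
Lemma dot_adjoint (R : realType) (u v : 'rV[R]_2) (A : 'M[R]_2) :
  dot (u *m - A^T) v = - dot u (v *m A).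
Proof.
have dotE (a b : 'rV[R]_2) : dot a b = (a *m b^T) 0 0.
  by rewrite mxE; apply: eq_bigr => i _; rewrite mxE.
by rewrite !dotE mulmxN mulNmx mxE -mulmxA -trmx_mul.
Qed.

Lemma le_mx_norm (R : realType) m n (A : 'M[R]_(m, n)) i j : `|A i j| <= `|A|.
Proof.
by rewrite [leRHS]/Num.Def.normr/= mx_normrE; exact: (le_bigmax _ _ (i, j)).
Qed.

Lemma mx_norm_le (R : realType) m n (A : 'M[R]_(m, n)) (c : R) : 0 <= c ->
  (forall i j, `|A i j| <= c) -> `|A| <= c.
Proof.
move=> c0 Ac; rewrite [leLHS]/Num.Def.normr/= mx_normrE.
by apply: bigmax_le => // -[i j] _ /=.
Qed.

(** The norm is the max norm, not the Euclidean one, hence the factor 2, the number of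
    coordinates. *)
Lemma dot_le (R : realType) (u v : 'rV[R]_2) : `|dot u v| <= 2 * `|u| * `|v|.
Proof.
rewrite (le_trans (ler_norm_sum _ _ _))//.
rewrite (@le_trans _ _ (\sum_(i < 2) `|u| * `|v|))//.
  by apply: ler_sum => i _; rewrite normrM ler_pM ?le_mx_norm.
by rewrite big_const_ord iter_addr_0 -mulrA mulr_natl.
Qed.

Lemma mulmx_norm_le (R : realType) (u : 'rV[R]_2) (A : 'M[R]_2) :
  `|u *m A| <= 2 * `|u| * `|A|.
Proof.
apply: mx_norm_le; first by rewrite !mulr_ge0.
move=> i j; rewrite mxE (le_trans (ler_norm_sum _ _ _))//.
rewrite (@le_trans _ _ (\sum_(i < 2) `|u| * `|A|))//.
  by apply: ler_sum => k _; rewrite normrM ler_pM ?le_mx_norm.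
by rewrite big_const_ord iter_addr_0 -mulrA mulr_natl.
Qed.

Lemma sqr_norm_le_dot (R : realType) (u : 'rV[R]_2) : `|u| ^+ 2 <= dot u u.
Proof.
have dot0 : 0 <= dot u u by apply: sumr_ge0 => i _; rewrite -expr2 sqr_ge0.
rewrite -[leRHS]sqr_sqrtr// ler_pXn2r ?nnegrE ?sqrtr_ge0//.
apply: mx_norm_le => [|i j]; first exact: sqrtr_ge0.
rewrite (ord1 i) -sqrtr_sqr ler_wsqrtr// /dot (bigD1 j)//= -expr2 lerDl.
by apply: sumr_ge0 => k _; rewrite -expr2 sqr_ge0.
Qed.

Lemma dot_le_sqr_norm (R : realType) (u : 'rV[R]_2) : dot u u <= 2 * `|u| ^+ 2.
Proof. by rewrite (le_trans (ler_norm _))// (le_trans (dot_le _ _))// expr2 mulrA. Qed.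

(** Vector-valued maps have no mean value equality; pairing with a fixed [z] reduces to a scalar
    function on the segment from [q] to [p]. The point [s] depends on [z]. *)
Lemma dot_mean_value (R : realType) (psi : 'rV[R]_2 -> 'rV[R]_2)
    (z p q : 'rV[R]_2) : (forall v, differentiable psi v) ->
  exists2 s : R, 0 <= s <= 1 &
    dot z (psi p - psi q) =
    dot z ((p - q) *m jacobian psi (q + s *: (p - q))).
Proof.
move=> dpsi.
have psiE (s : R) : is_derive s 1 (fun s => psi (q + s *: (p - q)))
    ((p - q) *m jacobian psi (q + s *: (p - q))).
  have /derivableP := @diff_derivable _ _ _ psi _ (p - q) (dpsi (q + s *: (p - q))).
  rewrite deriveEjacobian// => -[].
  have e : (fun h : R => h^-1 *: (psi (h *: (p - q) + (q + s *: (p - q))) -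
        psi (q + s *: (p - q)))) =
      (fun h : R => h^-1 *: (psi (q + (h *: (1 : R) + s) *: (p - q)) -
        psi (q + s *: (p - q)))).
    by apply/funext => h; rewrite scaler1 scalerDl addrCA.
  by rewrite /derivable /derive /= e => *; split.
have [s /andP[s0 s1]] :=
  mean_value (@ltr01 R) (fun s _ => is_derive_dot (is_derive_cst z s 1) (psiE s)).
rewrite !(scale1r, scale0r, addr0) subrKC subr0 mulr1 => h.
exists s; first by rewrite !ltW.
rewrite dotBr h (_ : dot 0 _ = 0) ?add0r// /dot big1// => i _.
by rewrite mxE mul0r.
Qed.

(** * Compactness along a curve, and primitives *)

Lemma continuous_bounded_on_segment (R : realType) (V : normedModType R)
    (g : R -> V) (a b : R) : continuous g ->
  exists2 M : R, 0 < M & forall t, a <= t <= b -> `|g t| <= M.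
Proof.
move=> cg; have [ab|ba] := leP a b; last first.
  by exists 1 => // t /andP[at_ /(le_trans at_)]; rewrite leNgt ba.
have [|c _ cmax] := @EVT_max R (fun t => `|g t|) a b ab.
  by apply: continuous_subspaceT => t; exact: (cvg_norm (cg t)).
exists (`|g c| + 1); first by rewrite ltr_wpDl.
by move=> t tab; rewrite (le_trans (cmax t _)) ?lerDl.
Qed.

(** Continuity at each point of the curve gives a local [eta]; compactness of the segment, as a
    near-covering property, makes it uniform in [t]. *)
Lemma uniform_continuity_along_curve (R : realType) (U V : normedModType R)
    (F : R * U * R -> V) (x : R -> U) (theta a b : R) :
  {within [set p : R * U * R | 0 <= p.2 <= 1], continuous F} -> continuous x ->
  forall w, 0 < w -> exists2 eta : R, 0 < eta &
    forall t v eps, a <= t <= b -> `|v - x t| <= eta -> 0 <= eps <= eta ->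
      `|F (t - theta, v, eps) - F (t - theta, x t, 0)| <= w.
Proof.
move=> /subspace_continuousP cF cx w w0.
pose P (eta t : R) := forall v eps, `|v - x t| <= eta -> 0 <= eps <= eta ->
  `|F (t - theta, v, eps) - F (t - theta, x t, 0)| <= w.
have cab : near_covering `[a, b] by apply/compact_near_coveringP/segment_compact.
have /cab : forall t, `[a, b]%classic t -> \forall t' \near t & eta \near 0^'+, P eta t'.
  move=> t _.
  have /cvgrPdist_lt/(_ (w / 2)) := cF (t - theta, x t, 0) ltac:(by rewrite /= lexx ler01).
  rewrite divr_gt0// => /(_ isT)/nbhs_ballP[d /= d0 dF].
  have /cvgrPdist_lt/(_ (d / 2)) := cx t.
  rewrite divr_gt0// => /(_ isT) xd.
  (* The bound [eta < 1] keeps [eps] in the strip where [F] is continuous. Half of [d] is spent on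
     moving from [x t] to [x t'], the other half on moving from [x t'] to [v]. *)
  exists ([set t' | `|t - t'| < d /\ `|x t - x t'| < d / 2], [set eta | eta < d / 2 /\ eta < 1]).
    split => /=.
      apply: filterI => //.
      by exists d.
    apply: filterI; apply: nbhs_right_lt => //.
    by rewrite divr_gt0.
  move=> [t' eta] /= [[tt' xx'] [etad eta1]] v eps vx /andP[eps0 epseta].
  have h u e : `|x t - u| < d -> 0 <= e <= eta ->
      `|F (t - theta, x t, 0) - F (t' - theta, u, e)| < w / 2.
    move=> xu /andP[e0 eeta]; apply: dF => /=; last first.
      by rewrite e0/= (le_trans eeta)// ltW.
    split; [split|] => /=.
    - by rewrite /ball/= (_ : _ - _ = t - t') //; ring.
    - by rewrite -ball_normE.
    suff : `|0 - e| < d by [].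
    rewrite sub0r normrN ger0_norm// (le_lt_trans eeta)//.
    by rewrite (lt_trans etad)// ltr_pdivrMr// ltr_pMr// ltr1n.
  have h1 : `|F (t - theta, x t, 0) - F (t' - theta, v, eps)| < w / 2.
    apply: h; last by rewrite eps0.
    rewrite -(subrK (x t') (x t)) -addrA (le_lt_trans (ler_normD _ _))//.
    rewrite (splitr d) ltrD// distrC (le_lt_trans vx)//.
  have h2 : `|F (t - theta, x t, 0) - F (t' - theta, x t', 0)| < w / 2.
    apply: h; last by rewrite lexx (le_trans eps0).
    by rewrite (lt_trans xx')// ltr_pdivrMr// ltr_pMr// ltr1n.
  rewrite -(subrKA (F (t - theta, x t, 0))) (le_trans (ler_normD _ _))//.
  by rewrite (splitr w) lerD// ltW// distrC.
move=> near0.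
near (0 : R)^'+ => eta.
exists eta; first by near: eta; exact: nbhs_right_gt.
move=> t v eps tab; have : `[a, b] `<=` P eta by near: eta.
by apply.
Unshelve. all: by end_near. Qed.

(** The primitive is the integral from [a]. Its derivative is given at interior points only, so it
    gets applied on an interval larger than the range of integration. *)
Lemma Rintegral_primitive (R : realType) (g : R -> R) (a b : R) :
  continuous g ->
  exists2 G : R -> R, forall t, a < t < b -> is_derive t (1 : R) G (g t) &
    forall s t, a < s -> s < t -> t < b ->
      \int[@lebesgue_measure R]_(u in `[s, t]) g u = G t - G s.
Proof.
move=> cg.
have ig s t : (@lebesgue_measure R).-integrable `[s, t] (EFin \o g).
  apply: continuous_compact_integrable; first exact: segment_compact.
  exact: continuous_subspaceT.
exists (fun t => \int[@lebesgue_measure R]_(u in `[a, t]) g u).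
  move=> t /andP[at_ tb].
  have [d1 d2] := continuous_FTC1_closed tb (ig a b) at_ (cg t).
  by split; [exact: d1|rewrite -derive1E; exact: d2].
move=> s t as_ st tb.
rewrite Rintegral_itvB ?bnd_simp ?(ltW as_) ?(ltW st)//.
rewrite Rintegral_itv_obnd_cbnd//.
by apply: integrableS (ig s t) => //; exact: subset_itv_oc_cc.
Qed.

(** * Growth of the distance between solutions, and the adjoint identity *)

(** With [e = p - q], the derivative of [E] is twice [dot e (psi p - psi q) + dot e v]. The first
    term is at most [4 * B * |e|^2], each of the two norm inequalities costing a factor 2, and the
    second at most [|e|^2 + m^2]. The bounds hold only in the tube of radius [eta], which [gronwall]
    shows is not left. *)
Lemma distance_growth (R : realType) (psi : 'rV[R]_2 -> 'rV[R]_2)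
    (p q v : R -> 'rV[R]_2) (a b B m eta : R) :
  let E t := dot (p t - q t) (p t - q t) in
  let bound := (E a + 2 * m ^+ 2 * (b - a)) * expR ((8 * B + 2) * (b - a)) in
  (forall v, differentiable psi v) -> 0 <= B -> 0 <= eta ->
  solution (fun t x => psi x + v t) p -> solution (fun=> psi) q ->
  (forall t, a <= t <= b -> `|p t - q t| <= eta -> `|v t| <= m /\
    forall s : R, 0 <= s <= 1 ->
      `|jacobian psi (q t + s *: (p t - q t))| <= B) ->
  bound < eta ^+ 2 ->
  forall t, a <= t <= b -> E t <= bound.
Proof.
move=> E bound dpsi B0 eta0 pE qE near_pq small.
have eE t := is_deriveB (pE t) (qE t).
have EE t := is_derive_dot (eE t) (eE t).
apply: (@gronwall _ E _ a b (8 * B + 2) (2 * m ^+ 2) (eta ^+ 2) _ _ _ EE).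
- by rewrite addr_ge0// mulr_ge0.
- by rewrite mulr_ge0// sqr_ge0.
- by apply: le_trans (sqr_norm_le_dot _); rewrite sqr_ge0.
- move=> t tab Et.
  have le_eta : `|p t - q t| <= eta.
    rewrite -(ler_pXn2r (n := 2))// ?nnegrE//.
    exact: le_trans (sqr_norm_le_dot _) Et.
  have [vm JB] := near_pq t tab le_eta.
  rewrite /= [dot _ (p t - q t)]dotC -mulr2n.
  rewrite (_ : psi (p t) + v t - psi (q t) = psi (p t) - psi (q t) + v t); last first.
    by rewrite addrAC.
  set e := p t - q t; rewrite dotDr.
  have [s /JB Js ->] := dot_mean_value e (p t) (q t) dpsi.
  have h1 : dot e (e *m jacobian psi (q t + s *: e)) <= 4 * B * `|e| ^+ 2.
    rewrite (le_trans (ler_norm _))// (le_trans (dot_le _ _))//.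
    rewrite (_ : 4 * B * _ = 2 * `|e| * (2 * `|e| * B)); last by ring.
    rewrite ler_wpM2l ?mulr_ge0//.
    by rewrite (le_trans (mulmx_norm_le _ _))// ler_wpM2l ?mulr_ge0.
  have h2 : dot e (v t) <= `|e| ^+ 2 + m ^+ 2.
    rewrite (le_trans (ler_norm _))// (le_trans (dot_le _ _))//.
    rewrite (@le_trans _ _ (2 * `|e| * m))// ?ler_wpM2l ?mulr_ge0//.
    by have := sqr_ge0 (`|e| - m); rewrite !expr2; lra.
  have h3 : (4 * B + 1) * `|e| ^+ 2 <= (4 * B + 1) * E t.
    by rewrite ler_wpM2l ?sqr_norm_le_dot// addr_ge0// mulr_ge0.
  by rewrite mulr2n; lra.
- exact: small.
Qed.

(** The function [H] below changes by exactly [- eps] times the integral, since [y - w] vanishes at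
    both ends. In its derivative the adjoint equation cancels the part linear in [A]; what remains
    is [O(eps * om)] because [y - w] is [O(eps)], and [eps] can be divided out. *)
Lemma adjoint_integral_bound (R : realType) (psi : 'rV[R]_2 -> 'rV[R]_2)
    (A : R -> 'M[R]_2) (z y w v g : R -> 'rV[R]_2) (a b eps C Z om : R) :
  a < b -> 0 < eps -> 0 <= C -> 0 <= Z -> (forall v, differentiable psi v) ->
  solution (linear_field (adjoint A)) z ->
  solution (fun t x => psi x + eps *: v t) y -> solution (fun=> psi) w ->
  y a = w a -> y b = w b -> continuous (fun t => dot (z t) (g t)) ->
  (forall t, a <= t <= b ->
    [/\ `|z t| <= Z, `|y t - w t| <= eps * C, `|v t - g t| <= om &
      forall s : R, 0 <= s <= 1 ->
        `|jacobian psi (w t + s *: (y t - w t)) - A t| <= om]) ->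
  `|\int[@lebesgue_measure R]_(t in `[a, b]) dot (z t) (g t)| <=
    (b - a) * ((4 * Z * C + 2 * Z) * om).
Proof.
move=> ab eps0 C0 Z0 dpsi zE yE wE yawa ybwb cg bounds.
have [G GE ->] := Rintegral_primitive (a - 1) (b + 1) cg; last 3 first.
- by rewrite ltrBlDr ltrDl.
- exact: ab.
- by rewrite ltrDl.
pose H t := dot (z t) (y t - w t) - eps * G t.
have HE t : a <= t <= b -> is_derive t (1 : R) H
    (dot (z t *m adjoint A t) (y t - w t) +
     dot (z t) (psi (y t) + eps *: v t - psi (w t)) -
     eps * dot (z t) (g t)).
  move=> /andP[at_ tb].
  have Gt : a - 1 < t < b + 1.
    by rewrite ltrBlDr (le_lt_trans at_) ?ltrDl// (le_lt_trans tb) ?ltrDl.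
  exact: is_deriveB (is_derive_dot (zE t) (is_deriveB (yE t) (wE t)))
    (is_deriveZ eps (GE t Gt)).
have [t /andP[at_ tb]] := mean_value ab HE.
have tab : a <= t <= b by rewrite !ltW.
have [zZ eC vg JA] := bounds t tab.
rewrite {1 2}/H yawa ybwb !subrr.
have -> : psi (y t) + eps *: v t - psi (w t) =
  (psi (y t) - psi (w t)) + eps *: v t by rewrite addrAC.
rewrite (dotDr _ (_ - psi _)).
have [s /JA Js ->] := dot_mean_value (z t) (y t) (w t) dpsi.
rewrite dot_adjoint; set e := y t - w t in eC Js *.
set J := jacobian _ _ in Js *.
have -> : - dot (z t) (e *m A t) + (dot (z t) (e *m J) + dot (z t) (eps *: v t))
   - eps * dot (z t) (g t) =
   dot (z t) (e *m (J - A t)) + eps * dot (z t) (v t - g t).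
  by rewrite mulmxBr !dotBr dotZr; ring.
have dot0 u : dot u (0 : 'rV[R]_2) = 0.
  by rewrite /dot big1// => i _; rewrite mxE mulr0.
rewrite !dot0 => Hba.
have h1 : `|dot (z t) (e *m (J - A t))| <= eps * (4 * Z * C * om).
  rewrite (le_trans (dot_le _ _))//.
  rewrite (_ : eps * _ = 2 * Z * (2 * (eps * C) * om)); last by ring.
  rewrite ler_pM ?mulr_ge0// ?ler_wpM2l//.
  by rewrite (le_trans (mulmx_norm_le _ _))// ler_pM ?mulr_ge0// ler_wpM2l.
have h2 : `|eps * dot (z t) (v t - g t)| <= eps * (2 * Z * om).
  rewrite normrM gtr0_norm// ler_wpM2l ?(ltW eps0)//.
  by rewrite (le_trans (dot_le _ _))// ler_pM ?mulr_ge0// ler_wpM2l.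
rewrite -(ler_pM2l eps0) -[X in X * `|_|]gtr0_norm// -normrM.
have -> : eps * (G b - G a) = - (0 - eps * G b - (0 - eps * G a)) by ring.
rewrite Hba normrN normrM [`|b - a|]gtr0_norm ?subr_gt0//.
rewrite [leRHS](_ : _ = (eps * (4 * Z * C * om) + eps * (2 * Z * om)) * (b - a)); last by ring.
rewrite ler_wpM2r ?subr_ge0 ?(ltW ab)//.
by rewrite (le_trans (ler_normD _ _))// lerD.
Qed.

(** * Continuity, convexity and a uniform lower bound *)

Lemma solution_continuous (R : realType) (V : normedModType R) (F : R -> V -> V)
    (x : R -> V) : solution F x -> continuous x.
Proof.
by move=> xE t; have [? _] := xE t; exact/differentiable_continuous/derivable1_diffP.
Qed.

Lemma continuous_dot (R : realType) (u v : R -> 'rV[R]_2) :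
  continuous u -> continuous v -> continuous (fun t => dot (u t) (v t)).
Proof.
move=> cu cv; apply: continuous_big => [|i _]; first exact: add_continuous.
move=> t; apply: cvgM.
  exact: (cvg_comp _ _ (cu t) (@coord_continuous _ _ _ 0 i (u t))).
exact: (cvg_comp _ _ (cv t) (@coord_continuous _ _ _ 0 i (v t))).
Qed.

Lemma segment_ball (R : realType) (V : normedModType R) (x p q : V)
    (eta s : R) : 0 <= s <= 1 -> `|p - x| <= eta -> `|q - x| <= eta ->
  `|q + s *: (p - q) - x| <= eta.
Proof.
move=> /andP[s0 s1] px qx.
have -> : q + s *: (p - q) - x = (1 - s) *: (q - x) + s *: (p - x).
  rewrite scalerBl scale1r -[RHS]addrA -scalerN -scalerDr opprB.
  by rewrite [x - q + _]addrC subrKA addrAC.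
rewrite (le_trans (ler_normD _ _))// !normrZ ger0_norm ?subr_ge0// ger0_norm//.
have -> : eta = (1 - s) * eta + s * eta by ring.
by rewrite lerD// ler_wpM2l// subr_ge0.
Qed.

(** Avoids square roots: a squared norm at most [eps ^+ 2 * D] gives a norm at most
    [eps * (1 + D)]. *)
Lemma le_sqr_add1 (R : realType) (a : R) : 0 <= a -> a <= (1 + a) ^+ 2.
Proof. by move=> a0; have := sqr_ge0 a; rewrite !expr2; lra. Qed.

(** The integral is continuous in [t], so its absolute value attains a positive minimum on the
    compact interval. Uniformity matters because the meeting time will depend on [eps]. *)
Lemma sliding_integral_bounded_below (R : realType) (g : R -> R) (T : R) :
  0 < T -> continuous g ->
  (forall t, 0 <= t <= T ->
    \int[@lebesgue_measure R]_(u in `[t - T, t]) g u != 0) ->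
  exists2 c : R, 0 < c & forall t, 0 <= t <= T ->
    c <= `|\int[@lebesgue_measure R]_(u in `[t - T, t]) g u|.
Proof.
move=> T0 cg g0.
have [G GE Gint] := Rintegral_primitive (- T - 1) (T + 1) cg.
have slide t : 0 <= t <= T ->
    \int[@lebesgue_measure R]_(u in `[t - T, t]) g u = G t - G (t - T).
  by move=> /andP[? ?]; apply: Gint; lra.
have cG t : - T - 1 < t < T + 1 -> {for t, continuous G}.
  move=> /GE[dG _]; exact/differentiable_continuous/derivable1_diffP.
have [|c] := @EVT_min R (fun t => `|G t - G (t - T)|) 0 T (ltW T0).
  apply: continuous_in_subspaceT => t; rewrite inE/= in_itv/= => /andP[t0 tT].
  apply: cvg_norm; apply: cvgB; first by apply: cG; lra.
  apply: (@cvg_comp _ _ _ (fun t => t - T) G _ (nbhs (t - T))).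
    by apply: cvgB; [exact: cvg_id|exact: cvg_cst].
  by apply: cG; lra.
rewrite in_itv/= => cT cmin; exists `|G c - G (c - T)|.
  by rewrite normr_gt0 -slide// g0.
by move=> t tT; rewrite slide// cmin// in_itv.
Qed.

Lemma continuous_within_comp (R : realType) (U V : topologicalType)
    (A : set U) (F : U -> V) (x : R -> U) :
  {within A, continuous F} -> continuous x -> (forall t, A (x t)) ->
  continuous (F \o x).
Proof.
move=> /subspace_continuousP cF cx Ax t.
move=> B /(cF _ (Ax t)) AB.
have nearB : \forall s \near t, A (x s) -> B (F (x s)) := cx t _ AB.
by apply: filterS nearB => s; exact.
Qed.

(** * Choice of the constants, and the contradiction at a meeting point *)

Theorem corollary2 (R : realType)
    (psi : 'rV[R]_2 -> 'rV[R]_2)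
    (phi : R -> 'rV[R]_2 -> R -> 'rV[R]_2)
    (T : R) (x0 : R -> 'rV[R]_2)
    (rhos : R) (z1 : R -> 'rV[R]_2)
    (theta0 : R) (x : R -> R -> 'rV[R]_2)
    (hpsi : C1 psi)
    (hphi : {within [set p : R * 'rV[R]_2 * R | 0 <= p.2 <= 1],
      continuous (fun p : R * 'rV[R]_2 * R => phi p.1.1 p.1.2 p.2)})
    (hphiT : forall (v : 'rV[R]_2) (eps : R), 0 <= eps <= 1 ->
      periodic (fun t => phi t v eps) T)
    (hx0 : limit_cycle psi T x0)
    (hsimple : simple_multiplier (linearization psi x0) T 1)
    (hrhos : rhos != 1)
    (hz1 : eigenfunction (adjoint (linearization psi x0)) T rhos z1)
    (htheta0 : 0 <= theta0 <= T)
    (hx : exists2 eps0 : R, 0 < eps0 <= 1 &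
      forall eps : R, 0 < eps < eps0 ->
        solution (fun t v => psi v + eps *: phi t v eps) (x eps) /\
        periodic (x eps) T)
    (hlim : forall t : R, 0 <= t <= T ->
      x eps (t - theta0) @[eps --> 0^'+] --> x0 t)
    (hf1 : forall t : R, 0 <= t <= T -> f1 phi x0 z1 T theta0 t != 0) :
  exists2 eps1 : R, 0 < eps1 &
    forall eps s t : R, 0 < eps < eps1 -> 0 <= s <= T -> 0 <= t <= T ->
      x eps s <> x0 t.
Proof.
have [dpsi cJ] := hpsi.
have [[x0E [T0 x0T _]] _] := hx0.
have [zE _ _] := hz1.
have [eps0 /andP[eps0_gt0 eps0_le1] xE] := hx.
have cx0 := solution_continuous x0E.
have cz := solution_continuous zE.
pose phi0 t := phi (t - theta0) (x0 t) 0.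
have cphi0 : continuous phi0.
  apply: (continuous_within_comp (x := fun t => (t - theta0, x0 t, 0)) hphi).
    move=> t.
    have ct : t' - theta0 @[t' --> t] --> t - theta0.
      by apply: cvgB; [exact: cvg_id|exact: cvg_cst].
    exact: (cvg_pair (cvg_pair ct (cx0 t)) (cvg_cst 0)).
  by move=> t /=; rewrite lexx ler01.
have cg := continuous_dot cz cphi0.
have [c c0 f1c] := sliding_integral_bounded_below T0 cg hf1.
(* Bounds are taken on [[-T, T]], which contains every window [[u - T, u]] with [u] in [[0, T]]. *)
have [Z Z0 zZ] := continuous_bounded_on_segment (- T) T cz.
have [M' M'0 phi0M] := continuous_bounded_on_segment (- T) T cphi0.
have [B' B'0 JB'] : exists2 B : R, 0 < B &
    forall t, - T <= t <= T -> `|jacobian psi (x0 t)| <= B.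
  apply: continuous_bounded_on_segment => t.
  exact: (cvg_comp _ _ (cx0 t) (cJ (x0 t))).
(* The added 1 absorbs the deviation [om <= 1] allowed in the tube around [x0]. *)
pose M := M' + 1; pose B := B' + 1.
have M0 : 0 < M by rewrite addr_gt0.
have B0 : 0 < B by rewrite addr_gt0.
(* [K] is the Gronwall factor over one period. For a perturbation of size [eps * M] and equal
   initial values, the bound of [distance_growth] is [eps ^+ 2 * D]. Then [X * om] is the bound of
   [adjoint_integral_bound] with [C = 1 + D], and [om] is chosen to make it less than [c]. *)
pose K := expR ((8 * B + 2) * T).
have K1 : 1 <= K.
  by rewrite -expR0 ler_expR mulr_ge0 ?(ltW T0)// addr_ge0// mulr_ge0// ltW.
have K0 : 0 < K by exact: lt_le_trans K1.
pose D := 2 * M ^+ 2 * T * K.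
have D0 : 0 < D by rewrite !mulr_gt0// exprn_gt0.
pose X := T * (4 * Z * (1 + D) + 2 * Z).
have X0 : 0 < X.
  by rewrite mulr_gt0// addr_gt0// mulr_gt0// ?mulr_gt0// addr_gt0.
pose om := Num.min 1 (c / (X + 1)).
have om0 : 0 < om by rewrite lt_min ltr01 divr_gt0// addr_gt0.
have omX : X * om < c.
  apply: (@le_lt_trans _ _ (X * (c / (X + 1)))).
    by rewrite ler_wpM2l ?(ltW X0)// ge_min lexx orbT.
  by rewrite mulrCA gtr_pMr// ltr_pdivrMr ?mul1r ?ltrDl// addr_gt0.
have om1 : om <= 1 by rewrite ge_min lexx.
(* The jacobian is viewed as a map of time, position and parameter so that the same uniform
   continuity lemma serves for it and for [phi]. *)
have cJ2 : {within [set p : R * 'rV[R]_2 * R | 0 <= p.2 <= 1],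
    continuous (fun p : R * 'rV[R]_2 * R => jacobian psi p.1.2)}.
  apply: continuous_subspaceT => p.
  apply: (@continuous_comp _ _ _ (fun p => p.1.2) (jacobian psi)); last exact: cJ.
  by apply: (@continuous_comp _ _ _ fst snd); [exact: cvg_fst|exact: cvg_snd].
have [etaJ etaJ0 tubeJ] :=
  uniform_continuity_along_curve 0 (- T) T cJ2 cx0 om0.
have [etaP etaP0 tubeP] :=
  uniform_continuity_along_curve theta0 (- T) T hphi cx0 om0.
pose eta := Num.min etaJ etaP.
have eta0 : 0 < eta by rewrite lt_min etaJ0.
have tubeJ' t v : - T <= t <= T -> `|v - x0 t| <= eta ->
    `|jacobian psi v - jacobian psi (x0 t)| <= om.
  move=> tT vx; apply: (tubeJ t v 0 tT); last by rewrite lexx ltW.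
  by rewrite (le_trans vx)// ge_min lexx.
have tubeP' t v eps : - T <= t <= T -> `|v - x0 t| <= eta -> 0 <= eps <= eta ->
    `|phi (t - theta0) v eps - phi0 t| <= om.
  move=> tT vx /andP[eps_ge0 epseta]; apply: (tubeP t v eps tT).
    by rewrite (le_trans vx)// ge_min lexx orbT.
  by rewrite eps_ge0 (le_trans epseta)// ge_min lexx orbT.
clearbody eta.
have JB t v : - T <= t <= T -> `|v - x0 t| <= eta -> `|jacobian psi v| <= B.
  move=> tT /(tubeJ' _ _ tT) h.
  rewrite -(subrK (jacobian psi (x0 t)) (jacobian psi v)) addrC.
  by rewrite (le_trans (ler_normD _ _))// lerD ?JB'// (le_trans h).
have phiM t v eps : - T <= t <= T -> `|v - x0 t| <= eta -> 0 <= eps <= eta ->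
    `|phi (t - theta0) v eps| <= M.
  move=> tT vx /(tubeP' _ _ _ tT vx) h.
  rewrite -(subrK (phi0 t) (phi _ _ _)) addrC.
  by rewrite (le_trans (ler_normD _ _))// lerD ?phi0M// (le_trans h).
(* Chosen so that [eps < epsM] yields [smallM]; together with [eta / (2 * K)] for the initial
   distance, it leaves each of the two terms of [d1] half of [eta ^+ 2 / K]. *)
pose epsM := eta / (2 * M * (1 + T) * K).
have epsM0 : 0 < epsM by rewrite divr_gt0// !mulr_gt0// addr_gt0.
have T00 : 0 <= (0 : R) <= T by rewrite lexx ltW.
have /cvgrPdist_le/(_ (eta / (2 * K))) := hlim 0 T00.
rewrite divr_gt0 ?mulr_gt0// => /(_ isT)[delta /= delta0 hdelta].
exists (Num.min (Num.min eps0 eta) (Num.min epsM delta)).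
  by rewrite !lt_min eps0_gt0 eta0 epsM0 delta0.
move=> eps s t0 /andP[eps_gt0]; rewrite !lt_min.
move=> /andP[/andP[eps_eps0 eps_eta] /andP[eps_epsM eps_delta]].
move=> /andP[s0 sT] /andP[t00 t0T] meet.
have [xepsE xepsT] := xE eps ltac:(by rewrite eps_gt0).
have epseta : 0 <= eps <= eta by rewrite !ltW.
pose y t := x eps (t - theta0).
pose v t := phi (t - theta0) (y t) eps.
have yE : solution (fun t x => psi x + eps *: v t) y.
  by move=> t; apply: is_derive_translate; exact: xepsE.
have yT t : y (t + T) = y t by rewrite /y addrAC xepsT.
(* In the shifted time the meeting occurs at [s + theta0], which lies in [[0, 2 * T]] and is brought
   back to [[0, T]] by periodicity. *)
have [u /andP[u0 uT] yu] : exists2 u, 0 <= u <= T & y u = x0 t0.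
  have /andP[th0 thT] := htheta0.
  have [le|gt] := leP (s + theta0) T.
    by exists (s + theta0); rewrite ?addr_ge0// /y addrK.
  exists (s + theta0 - T); last by rewrite -yT subrK /y addrK.
  by rewrite subr_ge0 (ltW gt) lerBlDr lerD.
pose w t := x0 (t + (t0 - u)).
have wE : solution (fun=> psi) w.
  by move=> t; apply: is_derive_translate; exact: x0E.
have wT t : w (t + T) = w t by rewrite /w addrAC x0T.
have wu : w u = y u by rewrite /w subrKC yu.
have yw_a : y (u - T) = w (u - T) by rewrite -yT -wT subrK wu.
have small0 : dot (y 0 - x0 0) (y 0 - x0 0) <= eta ^+ 2 / (2 * K ^+ 2).
  apply: le_trans (dot_le_sqr_norm _) _.
  have -> : eta ^+ 2 / (2 * K ^+ 2) = 2 * (eta / (2 * K)) ^+ 2.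
    by field; rewrite gt_eqF.
  rewrite ler_wpM2l// ler_pXn2r ?nnegrE ?divr_ge0 ?mulr_ge0 ?(ltW K0) ?(ltW eta0)//.
  rewrite distrC; apply: hdelta => //=.
  by rewrite sub0r normrN gtr0_norm.
have smallM : 2 * (eps * M) ^+ 2 * T < eta ^+ 2 / (2 * K ^+ 2).
  have : (eps * (2 * M * (1 + T) * K)) ^+ 2 < eta ^+ 2.
    rewrite ltr_pXn2r ?nnegrE ?(ltW eta0)//.
      by rewrite -ltr_pdivlMr// !mulr_gt0// addr_gt0.
    by rewrite !mulr_ge0// ?addr_ge0// ltW.
  rewrite ltr_pdivlMr ?mulr_gt0 ?exprn_gt0//; apply: le_lt_trans.
  rewrite [leRHS](_ : _ = 4 * (eps * M) ^+ 2 * K ^+ 2 * (1 + T) ^+ 2); last by ring.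
  rewrite [leLHS](_ : _ = 4 * (eps * M) ^+ 2 * K ^+ 2 * T); last by ring.
  rewrite ler_wpM2l//.
    by rewrite mulr_ge0 ?sqr_ge0// mulr_ge0 ?sqr_ge0.
  by rewrite le_sqr_add1// ltW.
have normE (e : 'rV[R]_2) (r : R) : 0 <= r -> dot e e <= r ^+ 2 -> `|e| <= r.
  move=> r0 er; rewrite -(ler_pXn2r (n := 2))// ?nnegrE//.
  exact: le_trans (sqr_norm_le_dot _) er.
(* Gronwall bound for the squared distance from [y] to [x0] over a period. The stronger [d1K]
   reserves a second factor [K], for the comparison of [w] with [x0]. *)
pose d1 := (dot (y 0 - x0 0) (y 0 - x0 0) + 2 * (eps * M) ^+ 2 * T) * K.
have d1K : d1 * K < eta ^+ 2.
  have : eta ^+ 2 = (eta ^+ 2 / (2 * K ^+ 2) + eta ^+ 2 / (2 * K ^+ 2)) * K * K.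
    by field; rewrite gt_eqF.
  by move=> ->; rewrite /d1 !ltr_pM2r// ler_ltD.
have d1_lt : d1 < eta ^+ 2.
  apply: le_lt_trans d1K; rewrite ler_peMr// mulr_ge0 ?(ltW K0)//.
  rewrite addr_ge0//; last by rewrite !mulr_ge0 ?sqr_ge0 ?ltW.
  by apply: le_trans (sqr_norm_le_dot _); rewrite sqr_ge0.
(* Gronwall runs forward from time 0 on [[0, T]]; periodicity of [y] and [x0] carries the estimate
   to negative times. *)
have yx0 t : - T <= t <= T -> dot (y t - x0 t) (y t - x0 t) <= d1.
  have pos t' : 0 <= t' <= T -> dot (y t' - x0 t') (y t' - x0 t') <= d1.
    move=> tT.
    have := @distance_growth R psi y x0 (fun t => eps *: v t) 0 T B (eps * M) eta
      dpsi (ltW B0) (ltW eta0) yE x0E.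
    rewrite subr0; apply => //.
    move=> {tT}t' /andP[t'0 t'T] near_x0.
    have t'TT : - T <= t' <= T by rewrite t'T andbT (le_trans _ t'0)// oppr_le0 ltW.
    split.
      by rewrite normrZ gtr0_norm// ler_wpM2l ?(ltW eps_gt0)// phiM.
    move=> r r01; apply: (JB t') => //; apply: segment_ball => //.
    by rewrite subrr normr0 ltW.
  move=> /andP[tT1 tT2]; have [t_ge0|t_lt0] := leP 0 t; first by rewrite pos// t_ge0.
  by rewrite -yT -x0T pos// -lerBlDr sub0r tT1 gerDr ltW.
have yx0' t : - T <= t <= T -> `|y t - x0 t| <= eta.
  by move=> /yx0 h; apply: normE; rewrite ?(ltW eta0)// (le_trans h)// ltW.
have uTT t : u - T <= t <= u -> - T <= t <= T.
  move=> /andP[a1 a2]; rewrite (le_trans _ a1) ?(le_trans a2)//.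
  by rewrite lerBrDr addNr.
(* The phase [t0 - u] is not estimated: [w] starts at [y (u - T)], already close to [x0 (u - T)],
   and both [w] and [x0] solve the unperturbed equation. *)
have wx0 t : u - T <= t <= u -> `|w t - x0 t| <= eta.
  move=> tu; apply: normE; first exact: ltW.
  have h0 : dot (w (u - T) - x0 (u - T)) (w (u - T) - x0 (u - T)) <= d1.
    by rewrite -yw_a; apply: yx0; apply: uTT; rewrite lexx gerBl ltW.
  have := @distance_growth R psi w x0 (fun=> 0) (u - T) u B 0 eta
      dpsi (ltW B0) (ltW eta0) _ x0E.
  rewrite expr0n/= mulr0 mul0r addr0 subKr -/K => h.
  apply: le_trans (h _ _ _ t tu) _.
  - by move=> t'; rewrite addr0; exact: wE.
  - move=> t' /uTT t'TT near_x0; split; first by rewrite normr0.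
    move=> r r01; apply: (JB t') => //; apply: segment_ball => //.
    by rewrite subrr normr0 ltW.
  - by apply: le_lt_trans d1K; rewrite ler_pM2r.
  - by apply: le_trans (ltW d1K); rewrite ler_pM2r.
have yw t : u - T <= t <= u -> `|y t - w t| <= eps * (1 + D).
  move=> tu.
  have E0 : dot (y (u - T) - w (u - T)) (y (u - T) - w (u - T)) = 0.
    by rewrite yw_a subrr /dot big1// => i _; rewrite mxE mul0r.
  have D0' : 0 <= eps * (1 + D) by rewrite mulr_ge0 ?(ltW eps_gt0)// addr_ge0// ltW.
  have epsD : (0 + 2 * (eps * M) ^+ 2 * T) * K <= (eps * (1 + D)) ^+ 2.
    rewrite (_ : _ * K = eps ^+ 2 * D); last by rewrite /D; ring.
    rewrite exprMn; apply: ler_wpM2l; first exact: sqr_ge0.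
    by rewrite le_sqr_add1// ltW.
  apply: normE => //; apply: (le_trans _ epsD).
  (* The radius need only exceed [eps * (1 + D)]; the jacobian bounds come from [yx0'] and [wx0],
     which place the segment from [w] to [y] in the tube around [x0]. *)
  have := @distance_growth R psi y w (fun t => eps *: v t) (u - T) u B (eps * M)
    (1 + eps * (1 + D)) dpsi (ltW B0) _ yE wE.
  rewrite E0 subKr; apply => //; first by rewrite addr_ge0.
    move=> t' t'u _; have t'TT := uTT _ t'u.
    split.
      by rewrite normrZ gtr0_norm// ler_wpM2l ?(ltW eps_gt0)// phiM// yx0'.
    by move=> r r01; apply: (JB t') => //; apply: segment_ball; rewrite ?yx0' ?wx0.
  apply: le_lt_trans epsD _; rewrite ltr_pXn2r ?nnegrE ?ltrDr//.
  by rewrite addr_ge0.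
have uT0 : u - T < u by rewrite gtrBl.
(* The integral at [u] has absolute value at least [c], while the adjoint estimate bounds it by
   [X * om < c]. *)
have := f1c u; rewrite u0 uT => /(_ isT).
apply/negP; rewrite -ltNge; apply: le_lt_trans omX.
have := adjoint_integral_bound (om := om) uT0 eps_gt0 (C := 1 + D) _ (ltW Z0) dpsi
  zE yE wE yw_a (esym wu) cg.
rewrite subKr mulrA -/X; apply; first by rewrite addr_ge0// ltW.
move=> t tu; have tTT := uTT _ tu; split; first exact: zZ.
- exact: yw.
- by apply: tubeP' => //; exact: yx0'.
- by move=> r r01; apply: tubeJ' => //; apply: segment_ball; rewrite ?yx0' ?wx0.
Qed.
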